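(* Let $I\subset\mathbb{R}$ be an interval and let $q:I\to\mathbb{H}$ be a regular quaternionic curve. Then there are real functions $\kappa_1,\kappa_2,\kappa_3$ on $I$ such that, with $\kappa=\kappa_1 i+\kappa_2 j+\kappa_3 k$, for all $t\in I$ $$\frac{d}{dt}\left(\frac{q'(t)}{|q'(t)|}\right)=\kappa(t)\,q'(t),$$ where the product on the right-hand side is quaternion multiplication.
   Context: $\mathbb{H}$ denotes the quaternions $q=x_0+x_1i+x_2j+x_3k$ with $x_\mu\in\mathbb{R}$ and $i^2=j^2=k^2=ijk=-1$; $\overline q=x_0-x_1i-x_2j-x_3k$ and $|q|^2=q\overline q$. A quaternionic curve is a map $q=x_0+x_1i+x_2j+x_3k:I\to\mathbb{H}$ whose components $x_\mu=x_\mu(t)$ are real $C^\infty$ functions on $I$; $q'=dq/dt$ is the componentwise derivative. The curve is regular if $q'(t)\neq 0$ for all $t\in I$. The pure imaginary quaternion-valued function $\kappa$ is called the quaternionic curvature of $q$. *)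

(* Defs.v *)
From Stdlib Require Import Reals Lra.
Open Scope R_scope.

(** [Quat x0 x1 x2 x3] stands for [x0 + x1 i + x2 j + x3 k]. *)
Record quat : Type := Quat { q0 : R; q1 : R; q2 : R; q3 : R }.

Definition qzero : quat := Quat 0 0 0 0.
Definition qone : quat := Quat 1 0 0 0.
Definition qi : quat := Quat 0 1 0 0.
Definition qj : quat := Quat 0 0 1 0.
Definition qk : quat := Quat 0 0 0 1.

Definition qadd (p q : quat) : quat :=
  Quat (q0 p + q0 q) (q1 p + q1 q) (q2 p + q2 q) (q3 p + q3 q).

Definition qscal (a : R) (q : quat) : quat :=
  Quat (a * q0 q) (a * q1 q) (a * q2 q) (a * q3 q).

Definition qmul (p q : quat) : quat :=
  Quat (q0 p * q0 q - q1 p * q1 q - q2 p * q2 q - q3 p * q3 q)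
       (q0 p * q1 q + q1 p * q0 q + q2 p * q3 q - q3 p * q2 q)
       (q0 p * q2 q - q1 p * q3 q + q2 p * q0 q + q3 p * q1 q)
       (q0 p * q3 q + q1 p * q2 q - q2 p * q1 q + q3 p * q0 q).

Definition qconj (q : quat) : quat := Quat (q0 q) (- q1 q) (- q2 q) (- q3 q).

(** [q * qconj q] is real (see [qnorm_sqr]), so its real part is all of it. *)
Definition qnorm (q : quat) : R := sqrt (q0 (qmul q (qconj q))).

Lemma hamilton :
  qmul qi qi = qscal (-1) qone /\ qmul qj qj = qscal (-1) qone /\
  qmul qk qk = qscal (-1) qone /\ qmul (qmul qi qj) qk = qscal (-1) qone.
Proof.
  repeat split; unfold qmul, qscal, qi, qj, qk, qone; simpl; f_equal; ring.
Qed.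

Lemma qnorm_sqr (q : quat) : qscal (qnorm q ^ 2) qone = qmul q (qconj q).
Proof.
  unfold qnorm; rewrite pow2_sqrt.
  - unfold qscal, qmul, qconj, qone; simpl; f_equal; ring.
  - unfold qmul, qconj; simpl; nra.
Qed.

(** Nondegenerate intervals, of any kind: open, closed, half-open, unbounded.
    Nondegeneracy makes every point of [I] a limit point of [I], so that
    derivatives relative to [I] are unique. *)
Definition is_interval (I : R -> Prop) : Prop :=
  (exists a b, I a /\ I b /\ a < b) /\
  (forall a b x, I a -> I b -> a <= x <= b -> I x).

(** [D_in f g I t] is differentiation relative to [I]: two-sided at interior
    points, one-sided at endpoints belonging to [I]. Only the values on [I] of
    the functions involved matter here and in the definitions below. *)
Definition is_deriv_on (I : R -> Prop) (f g : R -> R) : Prop :=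
  forall t, I t -> D_in f g I t.

(** [F n] is the [n]-th derivative of [f] on [I]. *)
Definition smooth_on (I : R -> Prop) (f : R -> R) : Prop :=
  exists F : nat -> R -> R,
    (forall t, I t -> F 0%nat t = f t) /\
    (forall n, is_deriv_on I (F n) (F (S n))).

Definition quat_curve (I : R -> Prop) (q : R -> quat) : Prop :=
  smooth_on I (fun t => q0 (q t)) /\ smooth_on I (fun t => q1 (q t)) /\
  smooth_on I (fun t => q2 (q t)) /\ smooth_on I (fun t => q3 (q t)).

Definition is_qderiv_on (I : R -> Prop) (q dq : R -> quat) : Prop :=
  is_deriv_on I (fun t => q0 (q t)) (fun t => q0 (dq t)) /\
  is_deriv_on I (fun t => q1 (q t)) (fun t => q1 (dq t)) /\
  is_deriv_on I (fun t => q2 (q t)) (fun t => q2 (dq t)) /\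
  is_deriv_on I (fun t => q3 (q t)) (fun t => q3 (dq t)).

(* Main.v *)
Require Import Defs.
From Stdlib Require Import Reals Lra.
Open Scope R_scope.

(** Write [v] for [q'] and [w] for [q''].  Differentiating [v / |v|] gives
    [w / |v| - <v, w> v / |v|^3], and since [|v|^2 = conj v * v], the right factor
    [v] can be pulled out:

      (v / |v|)' = |v|^-3 (w * conj v - <v, w>) v.

    The real part of [w * conj v] is exactly the Euclidean inner product
    [<v, w>], so the bracket is purely imaginary, and the curvature is
    [kappa = Im (w * conj v) / |v|^3].  The two
    halves are [qscal_inv_qnorm_deriv] and [curvature_identity].  Geometrically,
    [v / |v|] stays on the unit sphere, so its derivative is orthogonal to [v],
    and the quaternions orthogonal to [v] are the imaginary multiples of [v].

    The second derivative [w] comes from smoothness.  Smoothness provides some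
    tower of derivatives of [q], whereas [v] is an arbitrary derivative of [q];
    the two first derivatives coincide on [I] because no point of a nondegenerate
    interval is isolated ([deriv_on_unique]), and so [v] inherits the rest of the
    tower ([smooth_on_deriv]). *)

(** * Differentiation relative to an interval *)

Lemma interval_adherent (I : R -> Prop) (t : R) :
  is_interval I -> I t -> adhDa (D_x I t) t.
Proof.
  intros [[a [b [Ha [Hb Hab]]]] Hconv] Ht e He.
  destruct (Rlt_dec t b) as [Htb | Htb].
  - exists (t + Rmin (e / 2) (b - t)).
    assert (0 < Rmin (e / 2) (b - t)) by (apply Rmin_glb_lt; lra).
    pose proof (Rmin_l (e / 2) (b - t)).
    pose proof (Rmin_r (e / 2) (b - t)).
    split.
    + split; [apply (Hconv t b); auto; lra | lra].
    + unfold Rdist; rewrite Rabs_right; lra.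
  - exists (t - Rmin (e / 2) (t - a)).
    assert (0 < Rmin (e / 2) (t - a)) by (apply Rmin_glb_lt; lra).
    pose proof (Rmin_l (e / 2) (t - a)).
    pose proof (Rmin_r (e / 2) (t - a)).
    split.
    + split; [apply (Hconv a t); auto; lra | lra].
    + unfold Rdist; rewrite Rabs_left; lra.
Qed.

Lemma deriv_on_unique (I : R -> Prop) (f g h : R -> R) :
  is_interval I -> is_deriv_on I f g -> is_deriv_on I f h ->
  forall t, I t -> g t = h t.
Proof.
  intros HI Hg Hh t Ht.
  exact (single_limit _ _ _ _ _ (interval_adherent I t HI Ht)
           (Hg t Ht) (Hh t Ht)).
Qed.

Lemma deriv_on_ext (I : R -> Prop) (f1 f2 g1 g2 : R -> R) :
  (forall t, I t -> f1 t = f2 t) -> (forall t, I t -> g1 t = g2 t) ->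
  is_deriv_on I f1 g1 -> is_deriv_on I f2 g2.
Proof.
  intros Hf Hg H t Ht e He.
  destruct (H t Ht e He) as [d [Hd Hlim]].
  exists d; split; [exact Hd |].
  intros x [[Hx Hne] Hdist].
  rewrite <- (Hf x Hx), <- (Hf t Ht), <- (Hg t Ht).
  apply Hlim; repeat split; assumption.
Qed.

Lemma smooth_on_deriv (I : R -> Prop) (f g : R -> R) :
  is_interval I -> smooth_on I f -> is_deriv_on I f g -> smooth_on I g.
Proof.
  intros HI [F [HF0 HF]] Hg.
  exists (fun n => F (S n)); split; [| intro n; apply HF].
  apply (deriv_on_unique I f); auto.
  exact (deriv_on_ext I _ _ _ _ HF0 (fun t _ => eq_refl) (HF 0%nat)).
Qed.

Lemma smooth_on_derivable (I : R -> Prop) (f : R -> R) :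
  smooth_on I f -> exists g, is_deriv_on I f g.
Proof.
  intros [F [HF0 HF]]; exists (F 1%nat).
  exact (deriv_on_ext I _ _ _ _ HF0 (fun t _ => eq_refl) (HF 0%nat)).
Qed.

(** The outer function is differentiated at each value of [f] in the ordinary
    two-sided sense, so a chain rule relative to the image of [I] is avoided. *)
Lemma deriv_on_comp (I : R -> Prop) (f df g dg : R -> R) :
  is_deriv_on I f df ->
  (forall t, I t -> derivable_pt_lim g (f t) (dg (f t))) ->
  is_deriv_on I (fun t => g (f t)) (fun t => df t * dg (f t)).
Proof.
  intros Hf Hg t Ht.
  pose proof (proj2 (derivable_pt_lim_D_in g dg (f t)) (Hg t Ht)) as Hg'.
  pose proof (Dcomp I no_cond df dg f g t (Hf t Ht) Hg') as H.
  intros e He; destruct (H e He) as [d [Hd Hlim]].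
  exists d; split; [exact Hd |].
  intros x [[Hx Hne] Hdist].
  apply Hlim; repeat split; assumption.
Qed.

Lemma derivable_pt_lim_inv_sqrt (x : R) :
  0 < x -> derivable_pt_lim (fun y => / sqrt y) x (- / (2 * sqrt x ^ 3)).
Proof.
  intro Hx; pose proof (sqrt_lt_R0 x Hx) as Hs.
  apply (derivable_pt_lim_ext (fct_cte 1 / sqrt)%F).
  { intro y; unfold div_fct, fct_cte, Rdiv; ring. }
  replace (- / (2 * sqrt x ^ 3))
    with ((0 * sqrt x - / (2 * sqrt x) * fct_cte 1 x) / (sqrt x)²)
    by (unfold Rsqr, fct_cte; field; lra).
  apply derivable_pt_lim_div; [| | lra].
  - apply derivable_pt_lim_const.
  - apply derivable_pt_lim_sqrt; exact Hx.
Qed.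

(** * Quaternionic curves *)

Definition qdot (p q : quat) : R :=
  q0 p * q0 q + q1 p * q1 q + q2 p * q2 q + q3 p * q3 q.

Lemma qdot_self_pos (q : quat) : q <> qzero -> 0 < qdot q q.
Proof.
  intro Hq; destruct q as [a b c d]; unfold qdot; simpl.
  destruct (Req_dec a 0), (Req_dec b 0), (Req_dec c 0), (Req_dec d 0); try nra.
  exfalso; apply Hq; unfold qzero; subst; reflexivity.
Qed.

Lemma qnorm_qdot (q : quat) : qnorm q = sqrt (qdot q q).
Proof.
  unfold qnorm; f_equal; unfold qmul, qconj, qdot; simpl; ring.
Qed.

Lemma qnorm_pos (q : quat) : q <> qzero -> 0 < qnorm q.
Proof.
  intro Hq; rewrite qnorm_qdot; apply sqrt_lt_R0, qdot_self_pos, Hq.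
Qed.

Lemma qnorm_pow2 (q : quat) : qnorm q ^ 2 = qdot q q.
Proof.
  rewrite qnorm_qdot; apply pow2_sqrt; unfold qdot; nra.
Qed.

Lemma quat_curve_qderiv (I : R -> Prop) (q dq : R -> quat) :
  is_interval I -> quat_curve I q -> is_qderiv_on I q dq -> quat_curve I dq.
Proof.
  intros HI [S0 [S1 [S2 S3]]] [D0 [D1 [D2 D3]]].
  repeat split.
  - exact (smooth_on_deriv I _ _ HI S0 D0).
  - exact (smooth_on_deriv I _ _ HI S1 D1).
  - exact (smooth_on_deriv I _ _ HI S2 D2).
  - exact (smooth_on_deriv I _ _ HI S3 D3).
Qed.

Lemma quat_curve_derivable (I : R -> Prop) (q : R -> quat) :
  quat_curve I q -> exists dq, is_qderiv_on I q dq.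
Proof.
  intros [S0 [S1 [S2 S3]]].
  destruct (smooth_on_derivable _ _ S0) as [g0 H0].
  destruct (smooth_on_derivable _ _ S1) as [g1 H1].
  destruct (smooth_on_derivable _ _ S2) as [g2 H2].
  destruct (smooth_on_derivable _ _ S3) as [g3 H3].
  exists (fun t => Quat (g0 t) (g1 t) (g2 t) (g3 t)).
  repeat split; assumption.
Qed.

Lemma qdot_self_deriv (I : R -> Prop) (v w : R -> quat) :
  is_qderiv_on I v w ->
  is_deriv_on I (fun t => qdot (v t) (v t)) (fun t => 2 * qdot (v t) (w t)).
Proof.
  intros [H0 [H1 [H2 H3]]].
  eapply deriv_on_ext; cycle 2.
  - intros t Ht.
    exact (Dadd _ _ _ _ _ _
      (Dadd _ _ _ _ _ _
        (Dadd _ _ _ _ _ _ (Dmult _ _ _ _ _ _ (H0 t Ht) (H0 t Ht))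
                          (Dmult _ _ _ _ _ _ (H1 t Ht) (H1 t Ht)))
        (Dmult _ _ _ _ _ _ (H2 t Ht) (H2 t Ht)))
      (Dmult _ _ _ _ _ _ (H3 t Ht) (H3 t Ht))).
  - intros t _; reflexivity.
  - intros t _; unfold qdot; simpl; ring.
Qed.

Lemma inv_qnorm_deriv (I : R -> Prop) (v w : R -> quat) :
  is_qderiv_on I v w -> (forall t, I t -> v t <> qzero) ->
  is_deriv_on I (fun t => / qnorm (v t))
                (fun t => - qdot (v t) (w t) / qnorm (v t) ^ 3).
Proof.
  intros Hv Hne.
  eapply deriv_on_ext; cycle 2.
  - apply (deriv_on_comp I _ _ (fun y => / sqrt y)
             (fun y => - / (2 * sqrt y ^ 3)) (qdot_self_deriv I v w Hv)).
    intros t Ht.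
    apply derivable_pt_lim_inv_sqrt, qdot_self_pos, Hne, Ht.
  - intros t _; cbv beta; rewrite qnorm_qdot; reflexivity.
  - intros t Ht; cbv beta; rewrite <- qnorm_qdot.
    pose proof (qnorm_pos _ (Hne t Ht)); field; lra.
Qed.

Lemma qscal_deriv (I : R -> Prop) (a da : R -> R) (v w : R -> quat) :
  is_deriv_on I a da -> is_qderiv_on I v w ->
  is_qderiv_on I (fun t => qscal (a t) (v t))
    (fun t => qadd (qscal (da t) (v t)) (qscal (a t) (w t))).
Proof.
  intros Ha [H0 [H1 [H2 H3]]].
  repeat split; intros t Ht; simpl.
  - exact (Dmult _ _ _ _ _ _ (Ha t Ht) (H0 t Ht)).
  - exact (Dmult _ _ _ _ _ _ (Ha t Ht) (H1 t Ht)).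
  - exact (Dmult _ _ _ _ _ _ (Ha t Ht) (H2 t Ht)).
  - exact (Dmult _ _ _ _ _ _ (Ha t Ht) (H3 t Ht)).
Qed.

Lemma qscal_inv_qnorm_deriv (I : R -> Prop) (v w : R -> quat) :
  is_qderiv_on I v w -> (forall t, I t -> v t <> qzero) ->
  is_qderiv_on I (fun t => qscal (/ qnorm (v t)) (v t))
    (fun t => qadd (qscal (- qdot (v t) (w t) / qnorm (v t) ^ 3) (v t))
                   (qscal (/ qnorm (v t)) (w t))).
Proof.
  intros Hv Hne.
  apply (qscal_deriv I (fun t => / qnorm (v t))); [| exact Hv].
  apply inv_qnorm_deriv; assumption.
Qed.

Lemma qderiv_on_ext (I : R -> Prop) (q dq1 dq2 : R -> quat) :
  (forall t, I t -> dq1 t = dq2 t) -> is_qderiv_on I q dq1 ->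
  is_qderiv_on I q dq2.
Proof.
  intros Heq [H0 [H1 [H2 H3]]].
  repeat split.
  - exact (deriv_on_ext I _ _ _ _ (fun _ _ => eq_refl)
             (fun t Ht => f_equal q0 (Heq t Ht)) H0).
  - exact (deriv_on_ext I _ _ _ _ (fun _ _ => eq_refl)
             (fun t Ht => f_equal q1 (Heq t Ht)) H1).
  - exact (deriv_on_ext I _ _ _ _ (fun _ _ => eq_refl)
             (fun t Ht => f_equal q2 (Heq t Ht)) H2).
  - exact (deriv_on_ext I _ _ _ _ (fun _ _ => eq_refl)
             (fun t Ht => f_equal q3 (Heq t Ht)) H3).
Qed.

(** * The curvature *)

(** Right multiplication by [v] turns [w * conj v] into [|v|^2 w], and
    [<v, w>], the real part of [w * conj v], into [<v, w> v]; the difference of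
    the two, over [|v|^3], is the right-hand side. *)
Lemma curvature_identity (v w : quat) :
  v <> qzero ->
  let c := qscal (/ qnorm v ^ 3) (qmul w (qconj v)) in
  qmul (qadd (qadd (qscal (q1 c) qi) (qscal (q2 c) qj)) (qscal (q3 c) qk)) v
  = qadd (qscal (- qdot v w / qnorm v ^ 3) v) (qscal (/ qnorm v) w).
Proof.
  intro Hv; pose proof (qnorm_pos v Hv) as Hn.
  (* Over the common denominator [|v|^3] the identity is polynomial. *)
  assert (Hinv : / qnorm v = / qnorm v ^ 3 * qdot v v)
    by (rewrite <- qnorm_pow2; field; lra).
  rewrite Hinv; unfold Rdiv; generalize (/ qnorm v ^ 3); intro r.
  destruct v as [a b c d], w as [a' b' c' d'].
  unfold qmul, qadd, qscal, qconj, qdot, qi, qj, qk; simpl.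
  f_equal; ring.
Qed.

Theorem proposition3p1 (I : R -> Prop) (hI : is_interval I)
    (q dq : R -> quat)
    (hq : quat_curve I q)
    (hdq : is_qderiv_on I q dq)
    (hreg : forall t, I t -> dq t <> qzero) :
  exists k1 k2 k3 : R -> R,
    let kappa := fun t => qadd (qadd (qscal (k1 t) qi) (qscal (k2 t) qj))
                               (qscal (k3 t) qk) in
    is_qderiv_on I (fun t => qscal (/ qnorm (dq t)) (dq t))
                   (fun t => qmul (kappa t) (dq t)).
Proof.
  destruct (quat_curve_derivable I dq) as [ddq hddq].
  { exact (quat_curve_qderiv I q dq hI hq hdq). }
  pose (c := fun t => qscal (/ qnorm (dq t) ^ 3) (qmul (ddq t) (qconj (dq t)))).
  exists (fun t => q1 (c t)), (fun t => q2 (c t)), (fun t => q3 (c t)).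
  intro kappa.
  apply (qderiv_on_ext I _ _ _
           (fun t Ht => eq_sym (curvature_identity (dq t) (ddq t) (hreg t Ht)))).
  apply qscal_inv_qnorm_deriv; assumption.
Qed.
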